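(* Consider the heterogeneous bump regression (HBR) model with $|I_n|\searrow 0$, and let $(\varepsilon_n)$ be any sequence such that $\varepsilon_n\to 0$ and $\varepsilon_n\sqrt{-\log(|I_n|)}\to\infty$ as $n\to\infty$. 1. Let $\sigma_0\Delta_n=\sigma_n^2\theta_n$ with sequences $\Delta_n,\sigma_n,\theta_n\to 0$ as $n\to\infty$, where $\sigma_n^2=o(\varepsilon_n)$ and $\theta_n^2=o(\varepsilon_n)$. If $$\sqrt{n|I_n|}\,\Delta_n\precsim (2\sigma_0-\varepsilon_n)\sqrt{-\log(|I_n|)}\;\theta_n,$$ then the corresponding sequence of bump alternatives is undetectable. 2. Let $\sigma_n=\sigma(1+o(\varepsilon_n))$ with a constant $\sigma>0$ and $\Delta_n^2=o(\varepsilon_n)$ as $n\to\infty$, and put $\kappa:=\sigma/\sigma_0$. If $$\sqrt{n|I_n|}\precsim (C-\varepsilon_n)\sqrt{-\log(|I_n|)},\qquad C:=\frac{1}{\sqrt{\frac{\kappa^2}{2}-\frac12\log(1+\kappa^2)}},$$ then the corresponding sequence of bump alternatives is undetectable.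
   Context: HBR model: for each $n$ one observes $Y=(Y_1,\dots,Y_n)$ with $Y_i=\mu_n(i/n)+\lambda_n(i/n)Z_i$, where $Z_1,\dots,Z_n$ are i.i.d. $\mathcal N(0,1)$. The parameters $\sigma_0>0$ (fixed), $\Delta_n>0$, $\sigma_n>0$ and $|I_n|\in(0,1]$ are known; put $\kappa_n=\sigma_n/\sigma_0$. It is assumed that $l_n:=1/|I_n|\in\mathbb N$ and $n|I_n|\in\mathbb N$, and $\mathcal A_n:=\{((j-1)|I_n|,\,j|I_n|] : 1\le j\le l_n\}$, so that each interval in $\mathcal A_n$ contains exactly $n|I_n|$ of the points $i/n$. The null hypothesis is $H_0:\ \mu_n\equiv 0,\ \lambda_n\equiv\sigma_0$; the alternative is $H_1^n:$ there is $I_n\in\mathcal A_n$ with $\mu_n=\Delta_n 1_{I_n}$ and $\lambda_n^2=\sigma_0^2+\sigma_n^2 1_{I_n}$ (the position of $I_n$ is unknown). A test is a measurable map $\Phi_n:\mathbb R^n\to\{0,1\}$ (1 means reject $H_0$). Type I error: $\bar\alpha(\Phi_n)=\mathbb P_{H_0}(\Phi_n(Y)=1)$. Type II error: $\bar\beta(\Phi_n)=\sup_{I_n\in\mathcal A_n}\mathbb P_{\mu_n=\Delta_n1_{I_n},\,\lambda_n^2=\sigma_0^2+\sigma_n^21_{I_n}}(\Phi_n(Y)=0)$. The sequence of alternatives given by $(\Delta_n,\sigma_n,|I_n|)_{n}$ is called undetectable if for every $\alpha\in(0,1)$ and every sequence of tests $\Phi_n$ with $\bar\alpha(\Phi_n)\le\alpha+o(1)$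 one has $1-\bar\beta(\Phi_n)-\alpha\le o(1)$ as $n\to\infty$ (i.e. $\limsup_n(1-\bar\beta(\Phi_n))\le\alpha$). Notation: $a_n\precsim b_n$ means there is $N\in\mathbb N$ such that $a_n\le b_n$ for all $n\ge N$. *)

(* Defs.v *)
From HB Require Import structures.
From mathcomp Require Import all_boot all_order all_algebra.
From mathcomp Require Import all_classical all_reals all_analysis.

Set Implicit Arguments.
Unset Strict Implicit.
Unset Printing Implicit Defensive.

Import Order.TTheory GRing.Theory Num.Theory.
Import numFieldNormedType.Exports.

Local Open Scope classical_set_scope.
Local Open Scope ring_scope.

Definition mutually_independent (R : realType) (d : measure_display)
    (T : measurableType d) (P : probability T R) (n : nat)
    (X : 'I_n -> {RV P >-> R}) : Prop :=
  forall (J : {set 'I_n}) (A : 'I_n -> set R),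
    (forall i, measurable (A i)) ->
    P (\bigcap_(i in [set` J]) (X i @^-1` A i)) =
      (\prod_(i in J) P (X i @^-1` A i))%E.

Definition iid_std_normal (R : realType) (d : measure_display)
    (T : measurableType d) (P : probability T R) (n : nat)
    (Z : 'I_n -> {RV P >-> R}) : Prop :=
  mutually_independent Z /\
  forall (i : 'I_n) (A : set R), measurable A ->
    distribution P (Z i) A = normal_prob 0 1 A.

(* The sample [i = 1, ..., n] is indexed from zero, so entry [i : 'I_n] sits at
   the design point [i.+1 / n]. *)
Definition hbr_sample (R : realType) (T : Type) (n : nat)
    (mu lambda : R -> R) (Z : 'I_n -> T -> R) (w : T) : n.-tuple R :=
  [tuple mu (i.+1%:R / n%:R) + lambda (i.+1%:R / n%:R) * Z i w | i < n].

(* [h] is the common length of the intervals, whose inverse is a natural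
   number, so that [j%:R <= h^-1] says that [j] is at most their number. *)
Definition candidate_intervals (R : realType) (h : R) : set (set R) :=
  [set I | exists j : nat, [/\ (1 <= j)%N, j%:R <= h^-1 &
     I = [set` `](j%:R - 1) * h, j%:R * h]]]].

Definition bump_mean (R : realType) (Delta : R) (I : set R) : R -> R :=
  fun x => Delta * \1_I x.

Definition bump_sd (R : realType) (sigma0 s : R) (I : set R) : R -> R :=
  fun x => Num.sqrt (sigma0 ^+ 2 + s ^+ 2 * \1_I x).

(* Tests are boolean, [true] meaning that the null hypothesis is rejected. *)
Definition type1_error (R : realType) (d : measure_display)
    (T : measurableType d) (P : probability T R) (n : nat)
    (Z : 'I_n -> {RV P >-> R}) (sigma0 : R) (Phi : n.-tuple R -> bool) : R :=
  fine (P [set w | Phi (hbr_sample (cst 0) (cst sigma0) Z w) = true]).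

Definition type2_error (R : realType) (d : measure_display)
    (T : measurableType d) (P : probability T R) (n : nat)
    (Z : 'I_n -> {RV P >-> R}) (sigma0 Delta s h : R)
    (Phi : n.-tuple R -> bool) : R :=
  sup [set fine (P [set w |
         Phi (hbr_sample (bump_mean Delta I) (bump_sd sigma0 s I) Z w) = false])
      | I in candidate_intervals h].

(* u_n <= o(1) *)
Definition le_o1 (R : realType) (u : R^nat) : Prop :=
  exists2 r : R^nat, r @ \oo --> (0 : R) & forall n, u n <= r n.

Definition undetectable (R : realType) (d : nat -> measure_display)
    (T : forall n, measurableType (d n)) (P : forall n, probability (T n) R)
    (Z : forall n, 'I_n -> {RV (P n) >-> R})
    (sigma0 : R) (Delta sigma len : R^nat) : Prop :=
  forall (alpha : R) (Phi : forall n, n.-tuple R -> bool),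
    0 < alpha < 1 ->
    (forall n, measurable_fun [set: n.-tuple R] (Phi n)) ->
    le_o1 (fun n => type1_error (Z n) sigma0 (Phi n) - alpha) ->
    le_o1 (fun n =>
      1 - type2_error (Z n) sigma0 (Delta n) (sigma n) (len n) (Phi n) - alpha).

(* Main.v *)
Require Import Defs.
From HB Require Import structures.
From mathcomp Require Import all_boot all_order all_algebra.
From mathcomp Require Import all_classical all_reals all_analysis.
From mathcomp Require Import measurable_realfun ring lra.

(** Undetectability is a statement about an average of likelihood ratios.  Let
    [L_j] be the likelihood ratio of the bump in the [j]-th of the [l = 1/len]
    blocks against the null, each block holding [m = n len] observations.
    The worst case over the blocks is at least the average over them, so for a
    test [Phi]
    [[
      1 - type II <= (1/l) sum_j E_0[Phi L_j] <= type I + E_0|(1/l) sum_j L_j - 1|.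
    ]]
    Everything reduces to a weak law for the [L_j], which have mean one but
    possibly infinite variance.

    The weak law needs moments of product form only.  Truncate at the number of
    blocks, [M_j = min(L_j, l)].  For [0 <= dl <= 1] both the loss [L_j - M_j]
    and [M_j^2 / l] are at most [l^(-dl) L_j^(1+dl)], and for [j <> k] the
    product [M_j M_k] is at most [L_j L_k], of mean one since the blocks are
    disjoint.  If [E L_j^(1+dl) <= q l^dl], completing a square bounds the
    deviation by [q + 2 sqrt q] ([truncated_second_moment]).

    With [a = Delta/sigma0] and [k = (sigma/sigma0)^2], the log-likelihood ratio
    of one observation is the quadratic [bump_llr a (1 + k)]; its exponential
    moment of order [1 + dl] is an explicit Gaussian integral
    ([integral_bump_llr_moment]).  As [dl] goes to zero its logarithm is
    [dl ((k - ln (1 + k))/2 + O(dl k^2 + a^2))], so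
    [[
      ln q = - dl (- ln len - m ((k - ln (1 + k))/2 + O(dl k^2 + a^2))).
    ]]
    Take [dl = c eps].  If [m ((k - ln (1 + k))/2 + ...)] stays below
    [(1 - b eps) (- ln len)], then [ln q <= - b c eps^2 (- ln len)], which
    diverges by the hypothesis on [eps] ([undetectable_of_rate]).  The two
    regimes of the theorem are two ways to meet this rate condition: for [k]
    going to zero [(k - ln (1 + k))/2] is at most [k^2/4], which produces the
    constant [2 sigma0]; for [k] tending to [kappa^2] it tends to [C^(-2)].

    The passage from [E_0[Phi L_j]] to a probability under the alternative
    ([change_of_law_iid]) holds on boxes, by independence, and extends to all
    measurable sets of samples by uniqueness of measures. *)

Set Implicit Arguments.
Unset Strict Implicit.
Unset Printing Implicit Defensive.

Import Order.TTheory GRing.Theory Num.Theory.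
Import numFieldNormedType.Exports.

Local Open Scope classical_set_scope.
Local Open Scope ring_scope.

(** * Gaussian integrals *)

Section weight.

Import HBNNSimple.

(** A measure that is the image of a density [g] integrates like that density.
    It is used twice: for a law given by its density on the line, and for the
    image of a weighted probability by one coordinate of a sample. *)
Lemma ge0_integral_weight d1 d2 (X : measurableType d1) (Y : measurableType d2)
  (R : realType) (phi : X -> Y) (mu : {measure set X -> \bar R})
  (nu : {measure set Y -> \bar R}) (g : X -> R) (f : Y -> \bar R) :
  measurable_fun [set: X] phi -> measurable_fun [set: X] g ->
  (forall x, 0 <= g x) ->
  (forall B, measurable B -> nu B = \int[mu]_(x in phi @^-1` B) (g x)%:E)%E ->
  measurable_fun [set: Y] f -> (forall y, 0 <= f y)%E ->
  (\int[nu]_y f y = \int[mu]_x ((g x)%:E * f (phi x)))%E.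
Proof.
move=> mphi mg g0 nuE mf f0.
pose f_ := nnsfun_approx (@measurableT _ Y) mf.
transitivity (limn (fun n => \int[nu]_y (f_ n y)%:E))%E.
  rewrite -monotone_convergence//.
  - apply: eq_integral => y _; apply/esym/cvg_lim => //.
    exact: cvg_nnsfun_approx.
  - by move=> n; exact/measurable_EFinP.
  - by move=> n y _; rewrite lee_fin.
  - by move=> y _ m n mn; rewrite lee_fin; exact/lefP/nd_nnsfun_approx.
have mfn n : measurable_fun [set: X] (fun x => (f_ n (phi x))%:E).
  by apply/measurable_EFinP; exact: measurableT_comp.
transitivity (limn (fun n => \int[mu]_x ((g x)%:E * (f_ n (phi x))%:E)))%E; last first.
  rewrite -monotone_convergence//.
  - apply: eq_integral => x _; apply/cvg_lim => //.
    by apply: cvgeZl => //; apply: cvg_nnsfun_approx.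
  - by move=> n; apply: emeasurable_funM => //; exact/measurable_EFinP.
  - by move=> n x _; rewrite mule_ge0// lee_fin.
  - move=> x _ m n mn; apply: lee_wpmul2l; rewrite lee_fin//.
    by have /lefP := nd_nnsfun_approx (@measurableT _ Y) mf mn; exact.
apply: congr_lim; apply/funext => n.
have mpre r : measurable (f_ n @^-1` [set r]) by [].
have -> : (\int[nu]_y (f_ n y)%:E =
    \sum_(r \in range (f_ n)) \int[nu]_y (r * \1_(f_ n @^-1` [set r]) y)%:E)%E.
  under eq_integral do rewrite fimfunE -fsumEFin//.
  rewrite ge0_integral_fsum//.
  - by move=> r; exact/measurable_EFinP/measurableT_comp.
  - by move=> r y _; rewrite EFinM nnfun_muleindic_ge0.
under [RHS]eq_integral.
  move=> x _.
  rewrite fimfunE -fsumEFin// ge0_mule_fsumr; last first.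
    by move=> r; rewrite EFinM nnfun_muleindic_ge0.
  over.
rewrite [RHS]ge0_integral_fsum//; last 2 first.
  - move=> r; apply: emeasurable_funM; apply/measurable_EFinP => //.
    by apply: measurable_funM => //; apply: measurableT_comp.
  - by move=> r x _; apply: mule_ge0; rewrite ?EFinM ?nnfun_muleindic_ge0// lee_fin.
apply: eq_fsbigr => r _.
have [r0|r0] := leP 0 r; last first.
  by rewrite preimage_nnfun0// !integral0_eq// => x _;
    rewrite indic0 mulr0 ?mule0.
under eq_integral do rewrite EFinM.
under [RHS]eq_integral do rewrite EFinM muleCA.
rewrite ge0_integralZl//; last by apply/measurable_EFinP.
rewrite ge0_integralZl//; last 2 first.
  - apply: emeasurable_funM; apply/measurable_EFinP => //.
    exact: measurableT_comp.
  - by move=> x _; rewrite mule_ge0// lee_fin.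
congr (_ * _)%E.
rewrite integral_indic//= setIT nuE//.
rewrite integral_mkcond; apply: eq_integral => x _.
rewrite patchE indicE.
have -> : (phi x \in f_ n @^-1` [set r]) = (x \in phi @^-1` (f_ n @^-1` [set r])).
  by apply/idP/idP; rewrite !inE.
by case: ifPn => _; rewrite ?mule1 ?mule0.
Qed.

End weight.

(** The image of Lebesgue measure by [x |-> a + b x], scaled by [b], gives every
    interval its length, so it is Lebesgue measure. *)
Lemma ge0_integral_affine (R : realType) (a b : R) (f : R -> \bar R) :
  0 < b -> measurable_fun [set: R] f -> (forall x, 0 <= f x)%E ->
  (\int[lebesgue_measure]_x f x =
   b%:E * \int[lebesgue_measure]_x f (a + b * x)%R)%E.
Proof.
move=> b0 mf f0.
pose phi : measurableTypeR R -> measurableTypeR R := fun x => a + b * x.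
have mphi : measurable_fun [set: measurableTypeR R] phi.
  by apply: measurable_funD => //; exact: measurable_funM.
pose k : {nonneg R} := NngNum (ltW b0).
pose nu : {measure set (measurableTypeR R) -> \bar R} :=
  mscale k (measure_function_pushforward__canonical__measure_function_Measure
    lebesgue_measure mphi).
have muE : forall A, measurable A -> lebesgue_measure A = nu A.
  apply: lebesgue_measure_unique => _ [[c d]] /= cd <-.
  rewrite /nu /mscale/= /pushforward.
  have -> : phi @^-1` `]c, d] = `](c - a) / b, (d - a) / b]%classic.
    apply/seteqP; split => x; rewrite /phi /= !in_itv/=
      ltr_pdivrMr// ler_pdivlMr// ltrBlDl lerBrDl mulrC//.
  rewrite !lebesgue_measure_itv/= !lte_fin ltr_pM2r ?invr_gt0// ltrD2r.
  case: ifPn => _; last by rewrite mule0.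
  rewrite -!EFinB -EFinM; congr (_%:E); field; exact: lt0r_neq0.
transitivity (\int[nu]_x f x)%E.
  by apply: (eq_measure_integral nu) => A mA _; exact: muE.
rewrite ge0_integral_mscale//; congr (_ * _)%E.
by rewrite ge0_integral_pushforward.
Qed.

Lemma ge0_integral_normal_prob (R : realType) (m s : R) (f : R -> \bar R) :
  measurable_fun [set: R] f -> (forall x, 0 <= f x)%E ->
  (\int[normal_prob m s]_x f x =
   \int[lebesgue_measure]_x ((normal_pdf m s x)%:E * f x))%E.
Proof.
move=> mf f0.
apply: (@ge0_integral_weight _ _ (measurableTypeR R) (measurableTypeR R) R idfun
  lebesgue_measure (normal_prob m s) (normal_pdf m s) f) => //.
- exact: (@measurable_id _ (measurableTypeR R)).
- exact: (measurable_normal_pdf m s).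
- exact: normal_pdf_ge0.
Qed.

(** In this form the constant factor is the same for all normal densities, and
    identities between densities reduce to identities between exponents. *)
Lemma normal_pdf_expR (R : realType) (m s x : R) : 0 < s ->
  normal_pdf m s x =
  (Num.sqrt (pi *+ 2))^-1 * expR (- ln s - (x - m) ^+ 2 / (2 * s ^+ 2)).
Proof.
move=> s0; rewrite normal_pdfE ?gt_eqF// /normal_peak /normal_fun expRD expRN.
rewrite lnK// -mulrnAr sqrtrM ?sqr_ge0// sqrtr_sqr gtr0_norm// invfM.
rewrite [s^-1 * _]mulrC mulrA; congr (_ * _ * expR _).
by rewrite mulNr mulr_natl.
Qed.

(** The logarithm of the density of [N(a, v)] with respect to [N(0, 1)]. *)
Definition bump_llr (R : realType) (a v z : R) : R :=
  z ^+ 2 / 2 - (z - a) ^+ 2 / (2 * v) - ln v / 2.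

Lemma measurable_bump_llr (R : realType) (a v : R) :
  measurable_fun [set: R] (bump_llr a v).
Proof.
apply: measurable_funB => //; apply: measurable_funB.
  by apply: measurable_funM => //; exact: measurable_funX.
apply: measurable_funM => //; apply: measurable_funX.
exact: measurable_funB.
Qed.

Lemma ln_sqrt (R : realType) (v : R) : 0 < v -> ln (Num.sqrt v) = ln v / 2.
Proof.
move=> v0; rewrite -{2}[v]sqr_sqrtr ?ltW// lnXn ?sqrtr_gt0//.
by rewrite mulr2n; field.
Qed.

(** Both sides are integrals against [N(a, v)]: the left one by an affine change
    of variable, the right one through the density ratio. *)
Lemma ge0_integral_bump (R : realType) (a v : R) (f : R -> \bar R) : 0 < v ->
  measurable_fun [set: R] f -> (forall x, 0 <= f x)%E ->
  (\int[normal_prob 0 1]_z f (a + Num.sqrt v * z)%R =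
   \int[normal_prob 0 1]_z ((expR (bump_llr a v z))%:E * f z))%E.
Proof.
move=> v0 mf f0.
have s0 : 0 < Num.sqrt v by rewrite sqrtr_gt0.
have mphi : measurable_fun [set: R] (fun z => a + Num.sqrt v * z).
  by apply: measurable_funD => //; exact: measurable_funM.
have mllr : measurable_fun [set: R] (fun z => (expR (bump_llr a v z))%:E).
  apply/measurable_EFinP; apply: measurableT_comp => //.
  exact: measurable_bump_llr.
rewrite !ge0_integral_normal_prob//; last 3 first.
- exact: emeasurable_funM.
- by move=> x; rewrite mule_ge0// lee_fin expR_ge0.
- exact: measurableT_comp.
transitivity (\int[lebesgue_measure]_z
    ((normal_pdf a (Num.sqrt v) z)%:E * f z))%E; last first.
  apply: eq_integral => z _; rewrite muleA -EFinM; congr (_%:E * _)%E.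
  rewrite !normal_pdf_expR// -[RHS]mulrA; congr (_ * _).
  rewrite -expRD; congr expR; rewrite sqr_sqrtr ?ltW// ln_sqrt// ln1 /bump_llr; field.
  exact: lt0r_neq0.
have mpf : measurable_fun [set: R]
    (fun z => (normal_pdf a (Num.sqrt v) z)%:E * f z)%E.
  apply: emeasurable_funM mf; apply/measurable_EFinP.
  exact: measurable_normal_pdf.
rewrite [RHS](@ge0_integral_affine _ a (Num.sqrt v))//; last first.
- by move=> x; rewrite mule_ge0// lee_fin normal_pdf_ge0.
rewrite -ge0_integralZl//; last 2 first.
- exact: (measurableT_comp mpf mphi).
- by move=> x _; rewrite mule_ge0// lee_fin normal_pdf_ge0.
apply: eq_integral => z _; rewrite muleA -EFinM; congr (_%:E * _)%E.
rewrite !normal_pdf_expR// [RHS]mulrCA; congr (_ * _).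
rewrite -{1}[Num.sqrt v]lnK// -expRD; congr expR.
rewrite ln1 addrAC subrr add0r subr0 exprMn; field.
by rewrite lt0r_neq0.
Qed.

(** Completing the square in [(1 + dl) * bump_llr a v z - z ^+ 2 / 2] leaves a
    multiple of a normal density with variance [v / (1 - dl (v - 1))]; the
    integral is finite because that variance is positive. *)
Lemma integral_bump_llr_moment (R : realType) (a v dl : R) : 0 < v ->
  0 <= dl -> dl * (v - 1) < 1 ->
  (\int[normal_prob 0 1]_z (expR ((1 + dl) * bump_llr a v z))%:E =
   (expR (- (dl / 2) * ln v - ln (1 - dl * (v - 1)) / 2 +
          dl * (1 + dl) * a ^+ 2 / (2 * (1 - dl * (v - 1)))))%:E)%E.
Proof.
move=> v0 dl0 dlv.
set w := 1 - dl * (v - 1).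
have w0 : 0 < w by rewrite /w subr_gt0.
set K := expR _.
rewrite ge0_integral_normal_prob; last 2 first.
- apply/measurable_EFinP; apply: measurableT_comp => //.
  by apply: measurable_funM => //; exact: measurable_bump_llr.
- by move=> x; rewrite lee_fin expR_ge0.
pose s := Num.sqrt (v / w); pose m := (1 + dl) * a / w.
have vw0 : 0 < v / w by rewrite divr_gt0.
have s0 : 0 < s by rewrite sqrtr_gt0.
transitivity (\int[lebesgue_measure]_z (K%:E * (normal_pdf m s z)%:E))%E.
  apply: eq_integral => z _; rewrite -!EFinM; congr (_%:E).
  rewrite !normal_pdf_expR// -[LHS]mulrA [RHS]mulrCA; congr (_ * _).
  rewrite -!expRD; congr expR.
  rewrite sqr_sqrtr ?ltW// ln_sqrt// ln_div// ln1 /bump_llr /m.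
  rewrite /w; field.
  by rewrite -/w !lt0r_neq0.
rewrite ge0_integralZl//.
- by rewrite integral_normal_pdf mule1.
- by apply/measurable_EFinP; exact: measurable_normal_pdf.
- by move=> x _; rewrite lee_fin normal_pdf_ge0.
- by rewrite lee_fin expR_ge0.
Qed.

(** * Products of functions of independent variables *)

Lemma prod_indic (R : realType) (I : finType) (S : Type) (A : I -> set S)
  (x : I -> S) :
  \prod_i \1_(A i) (x i) = \1_[set y : I -> S | forall i, A i (y i)] x :> R.
Proof.
rewrite indicE; have [xA|xA] := boolP (x \in _).
  by rewrite big1// => i _; rewrite indicE mem_set//; move/set_mem: xA; apply.
have [i xi] : exists i, ~ A i (x i).
  by apply/existsNP; move/negP: xA; apply: contra_not => h; apply/mem_set.
by rewrite (bigD1 i)//= indicE memNset// mul0r.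
Qed.

Section iid_product.
Context (R : realType) (d : measure_display) (T : measurableType d)
  (P : probability T R) (n : nat) (Z : 'I_n -> {RV P >-> R}).
Hypothesis Z_iid : iid_std_normal Z.

Let law (i : 'I_n) (A : set R) : measurable A ->
  P (Z i @^-1` A) = normal_prob 0 1 A.
Proof. by move=> mA; rewrite -(Z_iid.2 i A mA). Qed.

(** Independence is given for events only.  Starting from a product of
    indicators, the indicators are replaced by the functions [f i] one coordinate
    at a time: with all other factors kept, the dependence on the [k]-th
    indicator is a multiple of the normal law, and two equal measures have the
    same integrals. *)
Lemma integral_prod_iid (f : 'I_n -> R -> R) (c : 'I_n -> R) :
  (forall i, measurable_fun [set: R] (f i)) -> (forall i x, 0 <= f i x) ->
  (forall i, (\int[normal_prob 0 1]_x (f i x)%:E = (c i)%:E)%E) ->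
  (\int[P]_w (\prod_i f i (Z i w))%:E = (\prod_i c i)%:E)%E.
Proof.
move=> mf f0 fc.
(* [k] counts the coordinates that already carry a general factor. *)
suff : forall k, (k <= n)%N -> forall (f : 'I_n -> R -> R) (c : 'I_n -> R),
  (forall i, measurable_fun [set: R] (f i)) -> (forall i x, 0 <= f i x) ->
  (forall i, (\int[normal_prob 0 1]_x (f i x)%:E = (c i)%:E)%E) ->
  (forall i : 'I_n, (k <= i)%N -> exists2 A : set R, measurable A & f i = \1_A) ->
  (\int[P]_w (\prod_i f i (Z i w))%:E = (\prod_i c i)%:E)%E.
  move=> /(_ n (leqnn n) f c); apply => // i.
  by rewrite leqNgt ltn_ord.
move: mf f0 fc => _ _ _; elim=> [_|k IH kn] {}f {}c mf f0 fc find.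
  have /choice[A HA] : forall i, exists A : set R, measurable A /\ f i = \1_A.
    by move=> i; have [A mA fA] := find i isT; exists A.
  have mA i := (HA i).1.
  pose B := \bigcap_(i in [set` [set: 'I_n]%SET]) Z i @^-1` A i.
  have mB : measurable B.
    apply: fin_bigcap_measurable => // i _.
    by rewrite -[X in measurable X]setTI; exact: measurable_funP.
  transitivity (\int[P]_w (\1_B w)%:E)%E.
    apply: eq_integral => w _; congr (_%:E).
    under eq_bigr do rewrite (HA _).2.
    rewrite prod_indic !indicE; congr (nat_of_bool _)%:R.
    apply/idP/idP => /set_mem wB; apply/mem_set => i; last first.
      by apply: wB => /=; rewrite inE.
    by move=> _; exact: wB.
  rewrite integral_indic// setIT; rewrite [LHS](Z_iid.1 [set: 'I_n]%SET A mA) -prodEFin.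
  rewrite (eq_bigl xpredT); last by move=> i; rewrite inE.
  apply: eq_bigr => i _; rewrite law// -fc (HA i).2.
  by rewrite integral_indic ?setIT//; exact: mA.
pose i0 := Ordinal kn.
pose c' := \prod_(i | i != i0) c i.
have c0 i : 0 <= c i.
  by rewrite -lee_fin -fc integral_ge0// => x _; rewrite lee_fin.
have c'0 : 0 <= c' by apply: prodr_ge0.
pose nu : {measure set (measurableTypeR R) -> \bar R} :=
  mscale (NngNum c'0) (normal_prob 0 1).
pose g w := \prod_(i | i != i0) f i (Z i w).
have mfZ i : measurable_fun [set: T] (fun w => f i (Z i w)).
  exact: measurableT_comp.
have mfE i : measurable_fun [set: R] (EFin \o f i).
  exact/measurable_EFinP.
transitivity (\int[nu]_x (f i0 x)%:E)%E; last first.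
  rewrite ge0_integral_mscale//.
  - by rewrite fc (bigD1 i0)//= -EFinM mulrC.
  - exact: (mfE i0).
  - by move=> x _; rewrite lee_fin.
rewrite (@ge0_integral_weight _ _ T (measurableTypeR R) R (Z i0) P nu g (EFin \o f i0))//.
- apply: eq_integral => w _; rewrite (bigD1 i0)//= EFinM muleC//.
- exact: (measurable_funP (Z i0)).
- rewrite (_ : g = fun w => \prod_i (if i != i0 then f i (Z i w) else 1)).
    apply: measurable_prod => i _; by case: (i != i0).
  by apply/funext => w; rewrite /g big_mkcond.
- by move=> w; apply: prodr_ge0.
- move=> B mB.
  have gamB : normal_prob 0 1 B \is a fin_num by exact: fin_num_measure.
  pose f' i := if i == i0 then \1_B else f i.
  pose e i := if i == i0 then fine (normal_prob 0 1 B) else c i.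
  have := IH (ltnW kn) f' e.
  rewrite [\prod_i e i](bigD1 i0)//= /e eqxx.
  rewrite (eq_bigr c); last by move=> i /negbTE ->.
  rewrite -/c' EFinM fineK// muleC => IH'.
  rewrite /nu/= /mscale/= -IH'.
  + rewrite [RHS]integral_mkcond; apply: eq_integral => w _.
    rewrite (bigD1 i0)//= /f' eqxx patchE indicE.
    rewrite (eq_bigr (fun i => f i (Z i w))); last by move=> i /negbTE ->.
    have -> : (Z i0 w \in B) = (w \in Z i0 @^-1` B).
      by apply/idP/idP; rewrite !inE.
    by case: ifPn => _; rewrite ?mul1r ?mul0r.
  + by move=> i; rewrite /f'; case: ifP => // _; exact: measurable_indic.
  + by move=> i x; rewrite /f'; case: ifP => // _; rewrite indicE.
  + move=> i; rewrite /f'; case: ifP => // _.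
    by rewrite integral_indic// setIT fineK.
  + move=> i ki; rewrite /f'; case: ifPn => [_|ni]; first by exists B.
    apply: find; rewrite ltn_neqAle ki andbT.
    by apply: contra ni => /eqP ki0; apply/eqP/val_inj.
- exact: (mfE i0).
- by move=> y; rewrite lee_fin.
Qed.

End iid_product.

(** * Change of law for samples *)

(** The boxes are stable by intersection, so two finite measures on samples are
    equal as soon as they agree on boxes. *)
Lemma measurable_tuple_boxes (R : realType) (n : nat) :
  @measurable _ (n.-tuple R) =
  <<s [set B | exists2 A : 'I_n -> set R, (forall i, measurable (A i)) &
        B = [set x | forall i, A i (tnth x i)]] >>.
Proof.
apply/seteqP; split.
  apply: smallest_sub; first exact: smallest_sigma_algebra.
  move=> B; rewrite -bigcup_seq => -[i _ [A mA <-]].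
  apply: sub_gen_smallest.
  exists (fun j => if j == i then A else setT).
    by move=> j; case: ifP.
  apply/seteqP; split => x /=.
    by move=> [_ Ax] j; case: eqP => // ->.
  by move=> /(_ i); rewrite eqxx.
apply: smallest_sub; first exact: sigma_algebra_measurable.
move=> _ [A mA ->].
rewrite (_ : [set _ | _] = \bigcap_(i in [set: 'I_n]) (@tnth _ R ^~ i) @^-1` A i).
  apply: fin_bigcap_measurable => // i _.
  by rewrite -[X in measurable X]setTI; exact: measurable_tnth.
by apply/seteqP; split => x /= h i => [_|]; apply: h.
Qed.

Section change_of_law.
Context (R : realType) (d : measure_display) (T : measurableType d)
  (P : probability T R) (n : nat) (Z : 'I_n -> {RV P >-> R}).
Hypothesis Z_iid : iid_std_normal Z.

(** The coordinatewise change of law tensorises: on a box both sides are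
    products of one-dimensional integrals. *)
Lemma change_of_law_iid (phi psi ell : 'I_n -> R -> R) :
  (forall i, measurable_fun [set: R] (phi i)) ->
  (forall i, measurable_fun [set: R] (psi i)) ->
  (forall i, measurable_fun [set: R] (ell i)) ->
  (forall i x, 0 <= ell i x) ->
  (forall i (A : set R), measurable A ->
    (\int[normal_prob 0 1]_z (\1_A (phi i z))%:E =
     \int[normal_prob 0 1]_z (ell i z * \1_A (psi i z))%:E)%E) ->
  forall D : set (n.-tuple R), measurable D ->
    (P [set w | D [tuple phi i (Z i w) | i < n]] =
     \int[P]_(w in [set w | D [tuple psi i (Z i w) | i < n]])
       (\prod_i ell i (Z i w))%:E)%E.
Proof.
move=> mphi mpsi mell ell0 swap D mD.
pose Y (f : 'I_n -> R -> R) w : n.-tuple R := [tuple f i (Z i w) | i < n].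
have mY f : (forall i, measurable_fun [set: R] (f i)) ->
    measurable_fun [set: T] (Y f).
  move=> mf; apply/measurable_fun_tnthP => i.
  rewrite (_ : _ \o _ = f i \o Z i); first exact: measurableT_comp.
  by apply/funext => w /=; rewrite /Y tnth_mktuple.
pose L w := \prod_i ell i (Z i w).
have mL : measurable_fun [set: T] L.
  by apply: measurable_prod => i _; exact: measurableT_comp.
have L0 w : 0 <= L w by apply: prodr_ge0.
pose m2 (B : set (n.-tuple R)) : \bar R := (\int[P]_(w in Y psi @^-1` B) (L w)%:E)%E.
have m20 : m2 set0 = 0%E by rewrite /m2 preimage_set0 integral_set0.
have m2ge0 B : (0 <= m2 B)%E.
  by apply: integral_ge0 => w _; rewrite lee_fin.
have mpre f B : (forall i, measurable_fun [set: R] (f i)) -> measurable B ->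
    measurable (Y f @^-1` B).
  by move=> mf mB; rewrite -[X in measurable X]setTI; exact: mY.
have m2sigma : semi_sigma_additive m2.
  move=> F mF tF mUF; rewrite /m2 preimage_bigcup ge0_integral_bigcup//.
  - apply: is_cvg_ereal_nneg_natsum_cond => k _ _; exact: m2ge0.
  - by move=> k; exact: mpre.
  - by apply: measurable_funTS; exact/measurable_EFinP.
  - by move=> w _; rewrite lee_fin.
  - apply/trivIsetP => i j _ _ ij; rewrite -preimage_setI.
    by move/trivIsetP : tF => /(_ _ _ _ _ ij) ->//; rewrite preimage_set0.
pose M2 : {measure set (n.-tuple R) -> \bar R} :=
  HB.pack m2 (isMeasure.Build _ _ _ m2 m20 m2ge0 m2sigma).
pose M1 : {measure set (n.-tuple R) -> \bar R} :=
  measure_function_pushforward__canonical__measure_function_Measure P (mY phi mphi).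
have setTbox : [set: n.-tuple R] = [set x | forall i, [set: R] (tnth x i)].
  by apply/seteqP; split.
apply: (@measure_unique _ R (n.-tuple R) _ (fun=> setT)
  (@measurable_tuple_boxes R n) _ _ _ M1 M2) => //.
- move=> _ _ [A mA ->] [A' mA' ->].
  exists (fun i => A i `&` A' i); first by move=> i; exact: measurableI.
  apply/seteqP; split => x /=; first by move=> [h h'] i; split.
  by move=> h; split=> i; case: (h i).
- by move=> _; exists (fun=> setT).
- by rewrite bigcup_const.
- move=> _ [A mA ->].
  have mbox : measurable [set x : n.-tuple R | forall i, A i (tnth x i)].
    by rewrite measurable_tuple_boxes; apply: sub_gen_smallest; exists A.
  have boxE f w : (w \in Y f @^-1` [set x | forall i, A i (tnth x i)]) =
      ((fun i => f i (Z i w)) \in [set y : 'I_n -> R | forall i, A i (y i)]).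
    by apply/idP/idP; rewrite !inE /= => h i; have := h i;
      rewrite /Y tnth_mktuple.
  pose f i z : R := \1_(A i) (phi i z).
  pose g i z : R := ell i z * \1_(A i) (psi i z).
  have mf i : measurable_fun [set: R] (f i) by exact: measurableT_comp.
  have mg i : measurable_fun [set: R] (g i).
    by apply: measurable_funM => //; exact: measurableT_comp.
  have mfE i : measurable_fun [set: R] (fun z => (f i z)%:E).
    exact/measurable_EFinP.
  have f0 i z : 0 <= f i z by rewrite /f indicE.
  have g0 i z : 0 <= g i z by rewrite /g indicE mulr_ge0.
  pose c i := fine (\int[normal_prob 0 1]_z (f i z)%:E)%E.
  have fE i : (\int[normal_prob 0 1]_z (f i z)%:E = (c i)%:E)%E.
    rewrite /c fineK// ge0_fin_numE ?integral_ge0//; last first.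
      by move=> z _; rewrite lee_fin.
    apply: (@le_lt_trans _ _ (\int[normal_prob 0 1]_z (cst 1%E z))%E).
      apply: ge0_le_integral => //.
      + by move=> z _; rewrite lee_fin.
      + exact: (mfE i).
      + by move=> z _; rewrite lee_fin /f indicE; case: (_ \in _).
    by rewrite integral_cst//= mul1e; rewrite [X in (X < _)%E]probability_setT ltry.
  have gE i : (\int[normal_prob 0 1]_z (g i z)%:E = (c i)%:E)%E.
    by rewrite -fE /f swap.
  transitivity (\int[P]_w (\prod_i f i (Z i w))%:E)%E.
    rewrite /M1/= /pushforward -[X in P X]setIT -integral_indic//; last exact: mpre.
    apply: eq_integral => w _; rewrite /f prod_indic !indicE.
    by rewrite boxE.
  transitivity ((\prod_i c i)%:E).
    exact: (integral_prod_iid Z_iid mf f0 fE).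
  transitivity (\int[P]_w (\prod_i g i (Z i w))%:E)%E.
    exact/esym/(integral_prod_iid Z_iid mg g0 gE).
  rewrite /M2/= /m2 [RHS]integral_mkcond; apply: eq_integral => w _.
  rewrite /g big_split/= prod_indic patchE indicE.
  rewrite boxE.
  by case: ifPn => _; rewrite ?mulr1 ?mulr0.
- move=> _; rewrite /M1/= /pushforward preimage_setT probability_setT ltry//.
Qed.

End change_of_law.

(** * A weak law by truncation *)

(** With [x = expR u] and [y = expR v], the last term is [x (x / y) ^ dl]: where
    [x] exceeds [y] it dominates [x]. *)
Lemma expR_le_min_tilt (R : realType) (dl u v : R) : 0 <= dl ->
  expR u <= Num.min (expR u) (expR v) + expR ((1 + dl) * u - dl * v).
Proof.
move=> dl0; have [uv|vu] := leP (expR u) (expR v).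
  by rewrite lerDl expR_ge0.
apply: ler_wpDl; first exact: expR_ge0.
rewrite ler_expR mulrDl mul1r -addrA lerDl -mulrBr mulr_ge0// subr_ge0.
by rewrite -ler_expR ltW.
Qed.

(** The same tilted term controls the square of the truncation, because
    [x ^ 2 <= y ^ (1 - dl) x ^ (1 + dl)] below the level [y]. *)
Lemma sqr_min_expR_le_tilt (R : realType) (dl u v : R) : 0 <= dl <= 1 ->
  Num.min (expR u) (expR v) ^+ 2 <= expR v * expR ((1 + dl) * u - dl * v).
Proof.
move=> /andP[dl0 dl1]; rewrite -expRD.
have [|] := leP (expR u) (expR v); rewrite ?ler_expR ?ltr_expR => uv;
  rewrite expr2 -expRD ler_expR; nra.
Qed.

(** The pointwise form of the weak law, with [expR (u j)] for the likelihood
    ratios and [b] for the value of a test.  All the terms are nonnegative and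
    the truncated variables occur in the proof only, so that integrating it
    calls for no integrability beyond the moments in sight. *)
Lemma truncated_sum_bound (R : realType) (l : nat) (u : 'I_l -> R)
  (dl t b : R) : (0 < l)%N -> 0 <= dl <= 1 -> 0 < t -> 0 <= b <= 1 ->
  (b + (2 * t)^-1) * \sum_j expR (u j) <=
  l%:R * (b + t + (4 * t)^-1)
  + (1 + 3 / (4 * t)) * \sum_j expR ((1 + dl) * u j - dl * ln l%:R)
  + (4 * t * l%:R)^-1 * \sum_j \sum_(k | k != j) expR (u j) * expR (u k).
Proof.
move=> l0 dl01 t0 /andP[b0 b1]; set La : R := l%:R.
have La0 : 0 < La by rewrite ltr0n.
pose y j := Num.min (expR (u j)) (expR (ln La)).
pose h j := expR ((1 + dl) * u j - dl * ln La).
have y0 j : 0 <= y j by rewrite le_min !expR_ge0.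
set X := \sum_j expR (u j); set H := (X in _ <= _ + _ * X + _).
set C := (X in _ <= _ + _ + _ * X).
pose S := \sum_j y j.
have H0 : 0 <= H by apply: sumr_ge0 => j _; exact: expR_ge0.
have XS : X <= S + H.
  rewrite -big_split/=; apply: ler_sum => j _; apply: expR_le_min_tilt.
  by case/andP: dl01.
have S2 : S ^+ 2 <= La * H + C.
  rewrite expr2 mulr_suml /H /C mulr_sumr -big_split/=; apply: ler_sum => j _.
  rewrite mulr_sumr (bigD1 j)//=; apply: lerD.
    by rewrite -expr2 -[X in X * expR _]lnK//; exact: sqr_min_expR_le_tilt.
  by apply: ler_sum => k _; rewrite ler_pM// ge_min lexx.
have Hb : b * X <= b * S + H.
  apply: (@le_trans _ _ (b * (S + H))); first exact: ler_wpM2l.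
  by rewrite mulrDr lerD2l ler_piMl.
have t4 : 0 < 4 * t * La by rewrite !mulr_gt0.
(* the square completed here is (S - La - 2 t b La)^2 *)
have SL : 4 * t * La * (b * (S - La)) <= 4 * t * La * (t * La) + (S - La) ^+ 2.
  have := sqr_ge0 (S - La - 2 * t * b * La).
  have : (b * (t * La)) ^+ 2 <= (t * La) ^+ 2.
    by rewrite exprMn ler_piMl ?sqr_ge0// exprn_ile1.
  nra.
rewrite -(ler_pM2l t4).
have -> : 4 * t * La * ((b + (2 * t)^-1) * X) =
    4 * t * La * (b * X) + 2 * La * X.
  by field; rewrite gt_eqF.
have -> : 4 * t * La * (La * (b + t + (4 * t)^-1) + (1 + 3 / (4 * t)) * H +
    (4 * t * La)^-1 * C) =
    4 * t * La * (La * (b + t)) + La ^+ 2 + (4 * t * La + 3 * La) * H + C.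
  by field; rewrite !gt_eqF.
have := ler_wpM2l (ltW t4) Hb.
have : 2 * La * X <= 2 * La * (S + H) by apply: ler_wpM2l => //; rewrite mulr_ge0 ?ltW.
nra.
Qed.

(** The choice [t = sqrt q] balances the two error terms [t] and [q / t] of
    [truncated_sum_bound]. *)
Lemma truncated_second_moment (R : realType) (d : measure_display)
  (T : measurableType d) (P : probability T R) (l : nat) (W : 'I_l -> T -> R)
  (dl q : R) (D : set T) :
  (0 < l)%N -> 0 <= dl <= 1 -> 0 < q ->
  (forall j, measurable_fun [set: T] (W j)) ->
  (forall j, (\int[P]_w (expR (W j w))%:E = 1)%E) ->
  (forall j k, k != j -> (\int[P]_w (expR (W j w) * expR (W k w))%:E = 1)%E) ->
  (forall j, (\int[P]_w (expR ((1 + dl) * W j w - dl * ln l%:R))%:E <= q%:E)%E) ->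
  measurable D ->
  (\sum_j \int[P]_(w in D) (expR (W j w))%:E <=
   (l%:R * (fine (P D) + q + 2 * Num.sqrt q))%:E)%E.
Proof.
move=> l0 dl01 q0 mW E1 E2 E3 mD.
set t := Num.sqrt q; have t0 : 0 < t by rewrite sqrtr_gt0.
have qt : q = t ^+ 2 by rewrite sqr_sqrtr// ltW.
set La : R := l%:R; have La0 : 0 < La by rewrite ltr0n.
have mexp j : measurable_fun [set: T] (fun w => (expR (W j w))%:E).
  by apply/measurable_EFinP; exact: measurableT_comp.
have mexp2 j k : measurable_fun [set: T] (fun w => (expR (W j w) * expR (W k w))%:E).
  by apply/measurable_EFinP; apply: measurable_funM; exact: measurableT_comp.
pose h j w := expR ((1 + dl) * W j w - dl * ln La).
have mh j : measurable_fun [set: T] (fun w => (h j w)%:E).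
  apply/measurable_EFinP; apply: measurableT_comp => //.
  by apply: measurable_funB => //; exact: measurable_funM.
have e0 j w : (0 <= (expR (W j w))%:E)%E by rewrite lee_fin expR_ge0.
pose lhs w : \bar R := (\sum_j ((\1_D w)%:E * (expR (W j w))%:E)
   + (2 * t)^-1%:E * \sum_j (expR (W j w))%:E)%E.
pose c1 := La * (t + (4 * t)^-1); pose c2 := 1 + 3 / (4 * t).
pose c3 := (4 * t * La)^-1.
pose rhs w : \bar R := (La%:E * (\1_D w)%:E + c1%:E + c2%:E * \sum_j (h j w)%:E
   + c3%:E * \sum_j \sum_(k | k != j) (expR (W j w) * expR (W k w))%:E)%E.
have c10 : 0 <= c1 by rewrite mulr_ge0 ?addr_ge0 ?invr_ge0 ?mulr_ge0 ?ltW.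
have c20 : 0 <= c2 by rewrite addr_ge0 ?divr_ge0 ?mulr_ge0 ?ltW.
have c30 : 0 <= c3 by rewrite invr_ge0 !mulr_ge0 ?ltW.
have lr w : (lhs w <= rhs w)%E.
  rewrite /lhs /rhs.
  have -> : (\sum_j (\1_D w)%:E * (expR (W j w))%:E =
      (\sum_j \1_D w * expR (W j w))%:E)%E by rewrite -sumEFin.
  have -> : (\sum_j \sum_(k | k != j) (expR (W j w) * expR (W k w))%:E =
      (\sum_j \sum_(k | k != j) expR (W j w) * expR (W k w))%:E)%E.
    by rewrite -sumEFin; apply: eq_bigr => j _; rewrite sumEFin.
  rewrite !sumEFin -!EFinM -!EFinD lee_fin.
  have b01 : 0 <= (\1_D w : R) <= 1.
    by rewrite indicE; case: (_ \in _); rewrite ?lexx ?ler01.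
  have := truncated_sum_bound (fun j => W j w) l0 dl01 t0 b01.
  rewrite -/La mulrDl mulr_sumr => /le_trans; apply.
  by rewrite -/c2 -/c3 /h lerD2r lerD2r /c1 -addrA mulrDr.
have t20 : (0 <= (2 * t)^-1%:E)%E by rewrite lee_fin invr_ge0 mulr_ge0 ?ltW.
have il : (\int[P]_w lhs w =
    \sum_j \int[P]_(w in D) (expR (W j w))%:E + ((2 * t)^-1 * La)%:E)%E.
  rewrite ge0_integralD//; last 4 first.
  - by move=> w _; apply: sume_ge0 => j _; rewrite mule_ge0// lee_fin.
  - apply: emeasurable_sum => j; apply: emeasurable_funM => //.
    exact/measurable_EFinP.
  - by move=> w _; apply: mule_ge0; [exact: t20|exact: sume_ge0].
  - by apply: emeasurable_funM => //; apply: emeasurable_sum.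
  congr (_ + _)%E.
    rewrite ge0_integral_sum//; last first.
      by move=> j; apply: emeasurable_funM => //; exact/measurable_EFinP.
    apply: eq_bigr => j _; rewrite [RHS]integral_mkcond; apply: eq_integral => w _.
    by rewrite patchE indicE; case: ifPn => _; rewrite ?mul1e ?mul0e.
  rewrite ge0_integralZl; [|exact: measurableT|exact: emeasurable_sum
    |by move=> w _; exact: sume_ge0|exact: t20].
  rewrite ge0_integral_sum// (eq_bigr (fun=> 1%:E)); last by move=> j _; rewrite E1.
  by rewrite sumEFin sumr_const card_ord -EFinM.
have mD1 : measurable_fun [set: T] (fun w => (\1_D w : R)%:E).
  exact/measurable_EFinP.
have mA : measurable_fun [set: T] (fun w => La%:E * (\1_D w : R)%:E)%E.
  exact: emeasurable_funM.
have mB : measurable_fun [set: T] (fun w => La%:E * (\1_D w : R)%:E + c1%:E)%E.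
  exact: emeasurable_funD.
have mH : measurable_fun [set: T] (fun w => \sum_j (h j w)%:E)%E.
  exact: emeasurable_sum.
have mcH : measurable_fun [set: T] (fun w => c2%:E * \sum_j (h j w)%:E)%E.
  exact: emeasurable_funM.
have mCj j : measurable_fun [set: T] (fun w =>
    \sum_(k | k != j) (expR (W j w) * expR (W k w))%:E)%E.
  rewrite (_ : (fun w => _) = (fun w =>
    \sum_(k <- [seq k <- index_enum 'I_l | k != j])
      (expR (W j w) * expR (W k w))%:E)%E).
    exact: emeasurable_sum.
  by apply/funext => w; rewrite big_filter.
have mC : measurable_fun [set: T] (fun w =>
    \sum_j \sum_(k | k != j) (expR (W j w) * expR (W k w))%:E)%E.
  exact: emeasurable_sum.
have mcC : measurable_fun [set: T] (fun w => c3%:E *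
    \sum_j \sum_(k | k != j) (expR (W j w) * expR (W k w))%:E)%E.
  exact: emeasurable_funM.
have ee0 j k w : (0 <= (expR (W j w) * expR (W k w))%:E)%E.
  by rewrite lee_fin mulr_ge0 ?expR_ge0.
have h0 j w : (0 <= (h j w)%:E)%E by rewrite lee_fin expR_ge0.
have A0 w : (0 <= La%:E * (\1_D w : R)%:E)%E.
  by rewrite -EFinM lee_fin mulr_ge0// ltW.
have B0 w : (0 <= La%:E * (\1_D w : R)%:E + c1%:E)%E.
  by rewrite adde_ge0// lee_fin.
have sH0 w : (0 <= \sum_j (h j w)%:E)%E by exact: sume_ge0.
have cH0 w : (0 <= c2%:E * \sum_j (h j w)%:E)%E.
  by rewrite mule_ge0// lee_fin.
have C0 w : (0 <= \sum_j \sum_(k | k != j) (expR (W j w) * expR (W k w))%:E)%E.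
  by apply: sume_ge0 => j _; apply: sume_ge0.
have cC0 w : (0 <= c3%:E *
    \sum_j \sum_(k | k != j) (expR (W j w) * expR (W k w))%:E)%E.
  by rewrite mule_ge0// lee_fin.
have ir : (\int[P]_w rhs w <= (La * fine (P D) + c1 + c2 * (La * q)
    + c3 * La ^+ 2)%:E)%E.
  rewrite ge0_integralD//; [|by move=> w _; exact: adde_ge0
    |exact: emeasurable_funD].
  rewrite ge0_integralD// ge0_integralD//.
  rewrite ge0_integralZl//; [|by rewrite lee_fin ltW].
  rewrite integral_indic// setIT integral_cst//.
  rewrite [X in (c1%:E * X)%E]probability_setT mule1.
  rewrite ge0_integralZl//.
  rewrite ge0_integralZl//.
  rewrite (EFinD _ (c3 * _)) (EFinD _ (c2 * _)) (EFinD _ c1).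
  apply: leeD; first apply: leeD; first apply: leeD => //.
  - by rewrite EFinM fineK// fin_num_measure.
  - rewrite (EFinM c2); apply: lee_wpmul2l; first by rewrite lee_fin.
    rewrite ge0_integral_sum//.
    apply: (@le_trans _ _ (\sum_(j < l) q%:E)%E).
      by apply: lee_sum => j _; exact: E3.
    by rewrite sumEFin sumr_const card_ord mulr_natl.
  - rewrite (EFinM c3); apply: lee_wpmul2l; first by rewrite lee_fin.
    rewrite ge0_integral_sum//; last by move=> j w _; exact: sume_ge0.
    apply: (@le_trans _ _ (\sum_(j < l) La%:E)%E); last first.
      by rewrite sumEFin sumr_const card_ord lee_fin expr2 mulr_natl.
    apply: lee_sum => j _; under eq_integral do rewrite -big_filter.
    rewrite ge0_integral_sum// big_filter.
    apply: (@le_trans _ _ (\sum_(k < l) 1%E)%E); last first.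
      by rewrite sumEFin sumr_const card_ord.
    rewrite big_mkcond/=; apply: lee_sum => k _; case: ifPn => // kj.
    by rewrite E2.
have lI : (\int[P]_w lhs w <= \int[P]_w rhs w)%E.
  apply: ge0_le_integral => //.
  - move=> w _; apply: adde_ge0; last by apply: mule_ge0 => //; exact: sume_ge0.
    by apply: sume_ge0 => j _; rewrite mule_ge0// lee_fin.
  - apply: emeasurable_funD; last first.
      by apply: emeasurable_funM => //; exact: emeasurable_sum.
    by apply: emeasurable_sum => j; exact: emeasurable_funM.
  - by do 2 apply: emeasurable_funD => //.
have := le_trans lI ir; rewrite il -leeBrDr// -EFinB => /le_trans; apply.
rewrite lee_fin.
have -> : La * fine (P D) + c1 + c2 * (La * q) + c3 * La ^+ 2 - (2 * t)^-1 * La =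
    La * (fine (P D) + q + 7 / 4 * t).
  by rewrite qt /c1 /c2 /c3; field; rewrite !gt_eqF.
by rewrite ler_pM2l// lerD2l ler_pM2r//; lra.
Qed.

(** * The likelihood ratio of a block *)

Section bump_likelihood.
Context (R : realType) (d : measure_display) (T : measurableType d)
  (P : probability T R) (n : nat) (Z : 'I_n -> {RV P >-> R}) (a v : R).
Hypothesis Z_iid : iid_std_normal Z.
Hypothesis v0 : 0 < v.

Let llr := bump_llr a v.

Let mllr (p : R) : measurable_fun [set: R] (fun z => expR (p * llr z)).
Proof.
apply: measurableT_comp => //; apply: measurable_funM => //.
exact: measurable_bump_llr.
Qed.

(** A boolean exponent switches the likelihood ratio on and off, according to
    whether an observation lies in the block under consideration. *)
Lemma integral_expR_llr (b : bool) :
  (\int[normal_prob 0 1]_z (expR (b%:R * llr z))%:E = 1)%E.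
Proof.
case: b; last first.
  under eq_integral do rewrite mul0r expR0.
  by rewrite integral_cst//= mul1e [LHS]probability_setT.
have := @integral_bump_llr_moment R a v 0 v0 (lexx 0).
rewrite !mul0r addr0 => /(_ ltr01) ->.
by rewrite !(oppr0, mul0r, addr0, add0r, ln1) expR0.
Qed.

Lemma integral_expR_sum_llr (p c : 'I_n -> R) :
  (forall i : 'I_n, (\int[normal_prob 0 1]_z (expR (p i * llr z))%:E = (c i)%:E)%E) ->
  (\int[P]_w (expR (\sum_i p i * llr (Z i w)))%:E = (\prod_i c i)%:E)%E.
Proof.
move=> pc; under eq_integral do rewrite expR_sum.
apply: (integral_prod_iid Z_iid (f := fun i z => expR (p i * llr z))) => //.
Qed.

End bump_likelihood.

Lemma card_block (l m : nat) (j : 'I_l) :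
  #|[pred i : 'I_(l * m) | (i %/ m == j)%N]| = m.
Proof.
rewrite -sum1_card big_mkcond/= -(big_mkord xpredT
  (fun i => if (i %/ m == j)%N then 1%N else 0%N)) big_nat_mul.
rewrite (bigD1_seq (j : nat)) ?iota_uniq//=; last by rewrite mem_index_iota/=.
rewrite [X in (_ + X)%N]big1 ?addn0 => [|b bj].
  rewrite big_nat (eq_bigr (fun=> 1%N)) -?big_nat; last first.
    move=> i /andP[ji ij]; suff -> : (i %/ m = j)%N by rewrite eqxx.
    have m0 : (0 < m)%N by case: m ji ij => // ; rewrite !muln0.
    by apply/eqP; rewrite eqn_leq leq_divRL// ji andbT -ltnS ltn_divLR.
  by rewrite sum_nat_const_nat muln1 mulSn addnK.
rewrite big_nat big1// => i /andP[bi ib].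
have m0 : (0 < m)%N by case: m bi ib => // ; rewrite !muln0.
suff -> : (i %/ m = b)%N by rewrite (negbTE bj).
by apply/eqP; rewrite eqn_leq leq_divRL// bi andbT -ltnS ltn_divLR.
Qed.

(** * The power of a test at a fixed sample size *)

Lemma design_point_in_block (R : realType) (n m i j : nat) (h : R) :
  (0 < n)%N -> (0 < m)%N -> n%:R * h = m%:R ->
  (i.+1%:R / n%:R \in `](j.+1%:R - 1) * h, j.+1%:R * h]) = (i %/ m == j)%N.
Proof.
move=> n0 m0 nh; have n0' : 0 < n%:R :> R by rewrite ltr0n.
have -> : h = m%:R / n%:R by rewrite -nh mulrAC divff ?mul1r// gt_eqF.
rewrite in_itv/= !mulrA ltr_pM2r ?invr_gt0// ler_pM2r ?invr_gt0//.
rewrite -natr1 addrK natr1 -!natrM ltr_nat ler_nat ltnS.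
by rewrite -leq_divRL// -ltn_divLR// ltnS eqn_leq andbC.
Qed.

(** The bound for a fixed sample size.  The exponent on the left of [<= q] is the
    logarithm of the moment of order [1 + dl] of the likelihood ratio of one
    block, a product of [m] equal factors, divided by [l ^ dl]. *)
Lemma bump_power_bound (R : realType) (d : measure_display)
  (T : measurableType d) (P : probability T R) (n : nat)
  (Z : 'I_n -> {RV P >-> R}) (sigma0 Delta s h dl q : R) (l m : nat)
  (Phi : n.-tuple R -> bool) :
  iid_std_normal Z -> 0 < sigma0 -> (0 < l)%N -> (0 < m)%N -> n = (l * m)%N ->
  h^-1 = l%:R -> n%:R * h = m%:R ->
  let k2 := (s / sigma0) ^+ 2 in
  0 <= dl <= 1 -> dl * k2 < 1 -> 0 < q ->
  expR (m%:R * (- (dl / 2) * ln (1 + k2) - ln (1 - dl * k2) / 2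
     + dl * (1 + dl) * (Delta / sigma0) ^+ 2 / (2 * (1 - dl * k2)))
     - dl * ln l%:R) <= q ->
  measurable_fun [set: n.-tuple R] Phi ->
  1 - type2_error Z sigma0 Delta s h Phi <=
  type1_error Z sigma0 Phi + q + 2 * Num.sqrt q.
Proof.
move=> Z_iid s0 l0 m0 nlm hl hm k2 dl01 dlk q0 Kq mPhi.
have n0 : (0 < n)%N by rewrite nlm muln_gt0 l0.
pose a := Delta / sigma0; pose v := 1 + k2.
have k20 : 0 <= k2 by exact: sqr_ge0.
have v0 : 0 < v by rewrite /v; lra.
pose I (j : 'I_l) : set R := [set` `](j.+1%:R - 1) * h, j.+1%:R * h]].
have cI j : candidate_intervals h (I j).
  by exists j.+1; split => //; rewrite hl ler_nat.
pose blk (j : 'I_l) (i : 'I_n) := (i %/ m == j)%N.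
have blkE (j : 'I_l) (i : 'I_n) : \1_(I j) (i.+1%:R / n%:R : R) = (blk j i)%:R :> R.
  rewrite indicE /I /blk -(design_point_in_block i j n0 m0 hm).
  by congr (nat_of_bool _)%:R; apply/idP/idP; rewrite inE.
pose llr := bump_llr a v.
pose W (j : 'I_l) w := \sum_i (blk j i)%:R * llr (Z i w).
pose Y (j : 'I_l) w := hbr_sample (bump_mean Delta (I j)) (bump_sd sigma0 s (I j)) Z w.
pose Y0 w := hbr_sample (cst 0) (cst sigma0) Z w.
pose D := [set w | Phi (Y0 w) = true].
have mB b : measurable (Phi @^-1` [set b]).
  by rewrite -[X in measurable X]setTI; exact: mPhi.
have maff (b c : R) : measurable_fun [set: R] (fun z => b + c * z).
  by apply: measurable_funD => //; exact: measurable_funM.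
have msample (mu lam : R -> R) : measurable_fun [set: T] (hbr_sample mu lam Z).
  apply/measurable_fun_tnthP => i.
  rewrite (_ : _ \o _ = (fun z => mu (i.+1%:R / n%:R) + lam (i.+1%:R / n%:R) * z) \o Z i).
    exact: measurableT_comp.
  by apply/funext => w /=; rewrite tnth_mktuple.
have mpre (mu lam : R -> R) b :
    measurable [set w | Phi (hbr_sample mu lam Z w) = b].
  rewrite -[X in measurable X]setTI.
  exact: (msample mu lam measurableT _ (mB b)).
have change j : P [set w | Phi (Y j w) = true] =
    (\int[P]_(w in D) (expR (W j w))%:E)%E.
  pose phi (i : 'I_n) z := bump_mean Delta (I j) (i.+1%:R / n%:R) +
    bump_sd sigma0 s (I j) (i.+1%:R / n%:R) * z.
  pose psi (i : 'I_n) (z : R) := (cst 0 (i.+1%:R / n%:R : R) : R) +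
    cst sigma0 (i.+1%:R / n%:R : R) * z.
  pose ell (i : 'I_n) z := expR ((blk j i)%:R * llr z).
  have mell i : measurable_fun [set: R] (ell i).
    apply: measurableT_comp => //; apply: measurable_funM => //.
    exact: measurable_bump_llr.
  have := @change_of_law_iid _ _ _ _ _ _ Z_iid phi psi ell
    (fun i => maff _ _) (fun i => maff _ _) mell
    (fun i z => expR_ge0 _) _ (Phi @^-1` [set true]) (mB true).
  move=> -> //.
    by apply: eq_integral => w _; rewrite /W expR_sum.
  move=> i A mA; rewrite /phi /psi /ell /bump_mean /bump_sd blkE /=.
  case: (blk j i); last first.
    rewrite !mulr0 addr0 sqrtr_sqr gtr0_norm//; apply: eq_integral => z _.
    by rewrite mul0r expR0 mul1r.
  have mf : measurable_fun [set: R] (fun z => (\1_A (0 + sigma0 * z) : R)%:E).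
    by apply/measurable_EFinP; apply: measurableT_comp => //; exact: maff.
  have f0 z : (0 <= (\1_A (0 + sigma0 * z) : R)%:E)%E by rewrite lee_fin.
  transitivity (\int[normal_prob 0 1]_z
      (\1_A (0 + sigma0 * (a + Num.sqrt v * z)) : R)%:E)%E.
    apply: eq_integral => z _; congr ((\1_A _)%:E).
    have -> : 0 + sigma0 * (a + Num.sqrt v * z) =
        Delta + sigma0 * Num.sqrt v * z by rewrite /a; field; rewrite gt_eqF.
    rewrite !mulr1 -[in RHS](gtr0_norm s0) -sqrtr_sqr -sqrtrM ?sqr_ge0//.
    congr (_ + Num.sqrt _ * _).
    by rewrite /v /k2; field; rewrite gt_eqF.
  rewrite (ge0_integral_bump a v0 mf f0); apply: eq_integral => z _.
  by rewrite mul1r -EFinM.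
(* The sum over the blocks of the powers of the test, on the null side. *)
have power : (\sum_j \int[P]_(w in D) (expR (W j w))%:E <=
   (l%:R * (fine (P D) + q + 2 * Num.sqrt q))%:E)%E.
  apply: (@truncated_second_moment _ _ _ _ _ _ dl) => //.
  - move=> j; apply: measurable_sum => i; apply: measurable_funM => //.
    by apply: measurableT_comp => //; exact: measurable_bump_llr.
  - move=> j; rewrite (integral_expR_sum_llr Z_iid (c := fun=> 1)) ?big1// => i.
    exact: integral_expR_llr.
  - move=> j k kj; under eq_integral do rewrite -expRD -big_split/=.
    under eq_integral do under eq_bigr do rewrite -mulrDl.
    rewrite (integral_expR_sum_llr Z_iid (c := fun=> 1)) ?big1// => i.
    have -> : (blk j i)%:R + (blk k i)%:R = (blk j i || blk k i)%:R :> R.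
      rewrite /blk; have [ij|_] := eqVneq (i %/ m)%N j; last by rewrite add0r.
      by rewrite ij eq_sym (val_eqE k j) (negbTE kj) addr0.
    exact: integral_expR_llr.
  - move=> j; set lK := (X in m%:R * X) in Kq.
    under eq_integral do rewrite addrC expRD mulr_sumr EFinM.
    under eq_integral do under eq_bigr do rewrite mulrA.
    rewrite ge0_integralZl; [|exact: measurableT|
      |by move=> w _; rewrite lee_fin expR_ge0|by rewrite lee_fin expR_ge0];
      last first.
      apply/measurable_EFinP; apply: measurableT_comp => //.
      apply: measurable_sum => i; apply: measurable_funM => //.
      by apply: measurableT_comp => //; exact: measurable_bump_llr.
    rewrite (integral_expR_sum_llr Z_iid
      (c := fun i => if blk j i then expR lK else 1)); last first.
      move=> i; case: (blk j i).
        rewrite mulr1 integral_bump_llr_moment//; last 2 first.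
        * by case/andP: dl01.
        * by rewrite /v addrAC subrr add0r.
        by rewrite /v [1 + k2 - 1]addrAC subrr add0r.
      by rewrite mulr0; exact: (integral_expR_llr a v0 false).
    rewrite -big_mkcond prodr_const -EFinM lee_fin.
    have -> : #|[pred i | blk j i]| = m.
      by move: (j); rewrite /blk; subst n => j'; exact: card_block.
    by rewrite -expRM_natl -expRD addrC.
  - exact: mpre.
have lR0 : 0 < l%:R :> R by rewrite ltr0n.
rewrite -(ler_pM2l lR0) -lee_fin; apply: le_trans power.
rewrite -[l%:R * (1 - _)]/(l%:R * (1 - _)) mulr_natl -[X in _ *+ X](card_ord l).
rewrite -sumr_const -sumEFin; apply: lee_sum => j _; rewrite -change.
rewrite -[leRHS]fineK ?fin_num_measure//; last exact: mpre.
rewrite lee_fin lerBlDr -lerBlDl.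
have -> : 1 - fine (P [set w | Phi (Y j w) = true]) =
    fine (P [set w | Phi (Y j w) = false]).
  rewrite (_ : [set w | Phi (Y j w) = false] = ~` [set w | Phi (Y j w) = true]).
    by rewrite probability_setC ?fineB ?fin_num_measure//; exact: mpre.
  by apply/seteqP; split => w /=; case: (Phi _).
apply: ub_le_sup; last by exists (I j).
exists 1 => _ [J _ <-].
by rewrite -lee_fin fineK ?fin_num_measure// probability_le1.
Qed.

(** * Rates that make the bumps undetectable *)

(** The function [ln y - (2 y - y ^ 2 / 2)] has derivative [(y - 1) ^ 2 / y]. *)
Lemma ln1D_ge (R : realType) (x : R) : 0 <= x -> x - x ^+ 2 / 2 <= ln (1 + x).
Proof.
rewrite le_eqVlt => /predU1P[<-|x0]; first by rewrite addr0 ln1 expr0n/=; lra.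
pose g : R -> R := (@ln R) - (2 *: id - 2^-1 *: (@GRing.exp R)^~ 2).
have dg (y : R) : 0 < y -> is_derive y (1:R) g (y^-1 - (2 - y)).
  move=> y0; have := is_derive1_ln y0 => dln.
  apply: is_derive_eq; rewrite /GRing.scale /= ?expr1. field; rewrite ?gt_eqF//.
have [|||c /itvP cx E] := @MVT R g (fun y => y^-1 - (2 - y)) 1 (1 + x).
- by rewrite ltrDl.
- by move=> y /itvP yx; apply: dg; rewrite (@lt_trans _ _ 1) ?yx//.
- apply: derivable_within_continuous => y /itvP yx.
  by have := dg y; rewrite (@lt_le_trans _ _ 1) ?yx// => /(_ isT) [].
have c0 : 0 < c by rewrite (@lt_trans _ _ 1) ?cx.
have : 0 <= (c^-1 - (2 - c)) * (1 + x - 1).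
  rewrite mulr_ge0//; last lra.
  have -> : c^-1 - (2 - c) = (c - 1) ^+ 2 / c by field; rewrite gt_eqF.
  by rewrite divr_ge0 ?sqr_ge0 ?ltW.
rewrite -E /g !fctE /GRing.scale/= ln1; lra.
Qed.

Lemma lnN1_le (R : realType) (x : R) : 0 <= x <= 2^-1 ->
  - ln (1 - x) <= x + 2 * x ^+ 2.
Proof.
move=> /andP[x0 x2]; have x1 : 0 < 1 - x by lra.
rewrite -lnV ?posrE//; have -> : (1 - x)^-1 = 1 + x / (1 - x).
  by field; rewrite gt_eqF.
apply: (@le_trans _ _ (x / (1 - x))).
  by apply: le_ln1Dx; apply: lt_le_trans (divr_ge0 x0 (ltW x1)); lra.
rewrite ler_pdivrMr//; nra.
Qed.

(** The left side is the logarithm of the moment in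
    [integral_bump_llr_moment], with [v = 1 + k] and [A = a ^ 2].  The linear
    term of [- ln (1 - dl k) / 2] completes [- ln (1 + k)] into
    [k - ln (1 + k)]. *)
Lemma log_moment_le (R : realType) (dl k A : R) :
  0 <= dl <= 1 -> 0 <= k -> 0 <= A -> dl * k <= 2^-1 ->
  - (dl / 2) * ln (1 + k) - ln (1 - dl * k) / 2
     + dl * (1 + dl) * A / (2 * (1 - dl * k)) <=
  dl * ((k - ln (1 + k)) / 2 + dl * k ^+ 2 + 2 * A).
Proof.
move=> /andP[dl0 dl1] k0 A0 dlk.
have x0 : 0 <= dl * k by rewrite mulr_ge0.
have := @lnN1_le _ (dl * k); rewrite x0 dlk => /(_ isT) Hln.
have : dl * (1 + dl) * A / (2 * (1 - dl * k)) <= 2 * dl * A.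
  rewrite ler_pdivrMr; last by lra.
  have : dl * A * (1 + dl) <= dl * A * (4 * (1 - dl * k)).
    by apply: ler_wpM2l; [exact: mulr_ge0|lra].
  lra.
nra.
Qed.

Lemma le_o1_near (R : realType) (u r : R^nat) :
  r @ \oo --> (0 : R) -> (\forall n \near \oo, u n <= r n) -> le_o1 u.
Proof.
move=> r0 [N _ ur]; exists (fun n => if (n < N)%N then u n else r n).
  apply: cvg_trans r0; apply: near_eq_cvg; exists N => // n /= Nn.
  by rewrite ltnNge Nn.
by move=> n; case: ltnP => // /ur.
Qed.

(* The index of the families [T], [P] and [Z] is kept explicit. *)
Unset Implicit Arguments.

Section rate.
Context (R : realType) (d : nat -> measure_display)
  (T : forall n : nat, measurableType (d n))
  (P : forall n : nat, probability (T n) R)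
  (Z : forall n : nat, 'I_n -> {RV (P n) >-> R}).
Hypothesis Z_iid : forall n : nat, iid_std_normal (Z n).
Context (sigma0 : R) (len eps : R^nat).
Hypothesis sigma0_gt0 : 0 < sigma0.
Hypothesis len_bounds : forall n : nat, (0 < n)%N -> 0 < len n <= 1.
Hypothesis len_inv_nat : forall n : nat, (0 < n)%N -> (len n)^-1 \is a Num.nat.
Hypothesis len_mul_nat :
  forall n : nat, (0 < n)%N -> n%:R * len n \is a Num.nat.
Hypothesis eps_cvg0 : eps @ \oo --> (0 : R).
Hypothesis eps_sqrt_log :
  (fun n => eps n * Num.sqrt (- ln (len n))) @ \oo --> +oo.

Set Implicit Arguments.

Lemma near_eps_gt0 : \forall n \near \oo, 0 < eps n.
Proof.
apply: filterS (cvgry_gt eps_sqrt_log 0) => n.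
by apply: contraTT; rewrite -!leNgt => en; exact: mulr_le0_ge0 en (sqrtr_ge0 _).
Qed.

Lemma near_eps_le (c : R) : 0 < c -> \forall n \near \oo, eps n <= c.
Proof.
move=> c0; move/cvgrPdist_le: eps_cvg0 => /(_ c c0); apply: filterS => n.
by rewrite sub0r normrN; exact: le_trans (ler_norm _).
Qed.

(** With [dl = c * eps n] and [q = exp (- b c eps ^ 2 (- ln len))], the bound
    [bump_power_bound] applies for large [n], and [q] goes to zero. *)
Lemma undetectable_of_rate (Delta sigma : R^nat) (b c : R) : 0 < b -> 0 < c ->
  (\forall n \near \oo, c * eps n * (sigma n / sigma0) ^+ 2 <= 2^-1) ->
  (\forall n \near \oo,
    n%:R * len n * (((sigma n / sigma0) ^+ 2 - ln (1 + (sigma n / sigma0) ^+ 2)) / 2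
      + c * eps n * (sigma n / sigma0) ^+ 2 ^+ 2 + 2 * (Delta n / sigma0) ^+ 2) <=
    (1 - b * eps n) * - ln (len n)) ->
  undetectable Z sigma0 Delta sigma len.
Proof.
move=> b0 c0 small rate alpha Phi _ mPhi [r r0 Hr].
pose q n := expR (- (b * c * (eps n * Num.sqrt (- ln (len n))) ^+ 2)).
have q0 : q @ \oo --> (0 : R).
  apply: (cvg_comp _ _ _ (@cvgr_expR R)).
  apply/cvgryPge => A.
  have bc : 0 < b * c by exact: mulr_gt0.
  near=> n.
  have h1 : 1 < eps n * Num.sqrt (- ln (len n)).
    by near: n; exact: cvgry_gt eps_sqrt_log 1.
  have h2 : A / (b * c) < eps n * Num.sqrt (- ln (len n)).
    by near: n; exact: cvgry_gt eps_sqrt_log (A / (b * c)).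
  rewrite mulrC -ler_pdivrMr//; apply: (le_trans (ltW h2)).
  by rewrite expr2 ler_peMl// ltW// (lt_trans ltr01).
have sq0 : (fun n => Num.sqrt (q n)) @ \oo --> (0 : R).
  by rewrite -[X in _ --> X](sqrtr0 R); apply: cvg_comp q0 _; exact: sqrt_continuous.
apply: (@le_o1_near _ _ (fun n => r n + (q n + 2 * Num.sqrt (q n)))).
  rewrite -[X in _ --> X](addr0 0); apply: cvgD => //.
  rewrite -[X in _ --> X](addr0 0); apply: cvgD => //.
  by rewrite -[X in _ --> X](mulr0 2); apply: cvgMr.
near=> n.
have n0 : (0 < n)%N by near: n; exists 1%N.
have e0 : 0 < eps n by near: n; exact: near_eps_gt0.
have ce1 : c * eps n <= 1.
  rewrite mulrC -ler_pdivlMr// mul1r; near: n; apply: near_eps_le.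
  by rewrite invr_gt0.
have sm : c * eps n * (sigma n / sigma0) ^+ 2 <= 2^-1 by near: n.
have rt : n%:R * len n * (((sigma n / sigma0) ^+ 2 -
    ln (1 + (sigma n / sigma0) ^+ 2)) / 2 + c * eps n * (sigma n / sigma0) ^+ 2 ^+ 2
    + 2 * (Delta n / sigma0) ^+ 2) <= (1 - b * eps n) * - ln (len n) by near: n.
have [l hl] := natrP (len_inv_nat n n0).
have [m hm] := natrP (len_mul_nat n n0).
have /andP[h0 h1] := len_bounds n n0.
have nlm : n = (l * m)%N.
  apply/eqP; rewrite -(eqr_nat R) natrM -hl -hm mulrC -mulrA divff ?mulr1//.
  by rewrite gt_eqF.
have [l0 m0] : (0 < l)%N /\ (0 < m)%N.
  by move: n0; rewrite nlm muln_gt0 => /andP.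
set k := (sigma n / sigma0) ^+ 2 in sm rt.
have k0 : 0 <= k by exact: sqr_ge0.
have ce01 : 0 <= c * eps n <= 1 by rewrite ce1 mulr_ge0 ?ltW.
have power := @bump_power_bound R _ _ (P n) n (Z n) sigma0 (Delta n) (sigma n)
  (len n) (c * eps n) (q n) l m (Phi n) (Z_iid n) sigma0_gt0 l0 m0 nlm hl hm
  ce01 _ (expR_gt0 _) _ (mPhi n).
have {}Hr := Hr n.
suff : 1 - type2_error (Z n) sigma0 (Delta n) (sigma n) (len n) (Phi n) <=
  type1_error (Z n) sigma0 (Phi n) + q n + 2 * Num.sqrt (q n) by lra.
apply: power; first by rewrite -/k; lra.
rewrite /q ler_expR -/k.
have lnl : ln l%:R = - ln (len n) by rewrite -hl lnV.
have Lg0 : 0 <= - ln (len n) by rewrite oppr_ge0 ln_le0.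
rewrite [(eps n * _) ^+ 2]exprMn sqr_sqrtr// lnl -hm.
have := log_moment_le ce01 k0 (sqr_ge0 (Delta n / sigma0)) sm.
move=> /(ler_wpM2l (ler0n R m)); rewrite -hm => lm.
have e := ler_wpM2l (mulr_ge0 (ltW c0) (ltW e0)) rt.
apply: (@le_trans _ _ (c * eps n * ((1 - b * eps n) * - ln (len n))
  - c * eps n * - ln (len n))).
  rewrite lerD2r; apply: (le_trans lm); rewrite mulrCA; apply: e.
by rewrite le_eqVlt; apply/orP; left; apply/eqP; ring.
Unshelve. all: end_near.
Qed.

End rate.

(** * The two regimes *)

Section two_regimes.
Context (R : realType).
Implicit Types x y k m L e : R.

Lemma subr_ln1D_le x : 0 <= x -> (x - ln (1 + x)) / 2 <= x ^+ 2 / 4.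
Proof. by move=> x0; have := @ln1D_ge R x x0; lra. Qed.

(** The function [x - ln (1 + x)] is increasing and 1-Lipschitz on the
    nonnegative half-line. *)
Lemma subr_ln1D_lip x y : 0 <= x -> 0 <= y ->
  (y - ln (1 + y)) / 2 <= (x - ln (1 + x)) / 2 + `|y - x| / 2.
Proof.
move=> x0 y0; have [yx|xy] := leP y x.
  have y1 : 0 < 1 + y by lra.
  have : ln (1 + x) - ln (1 + y) <= x - y.
    rewrite -ln_div ?posrE//; last lra.
    have -> : (1 + x) / (1 + y) = 1 + (x - y) / (1 + y).
      by field; rewrite gt_eqF.
    have xy1 : 0 <= (x - y) / (1 + y) by rewrite divr_ge0// ?subr_ge0// ltW.
    apply: le_trans (le_ln1Dx _) _; first lra.
    by rewrite ler_pdivrMr// ler_peMr ?subr_ge0//; lra.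
  by have := normr_ge0 (y - x); lra.
have : ln (1 + x) <= ln (1 + y) by rewrite ler_ln ?posrE; lra.
by have := ler_norm (y - x); lra.
Qed.

(** The terms [dl * k ^+ 2] and [2 * (k * t) ^+ 2] add up to at most [e] times the
    main term [k ^+ 2 / 4], and [(1 - e) ^ 2 (1 + e) <= 1 - e]. *)
Lemma vanishing_rate m k L e dl t : 0 <= m -> 0 <= k -> 0 <= L ->
  0 <= e <= 1 -> 0 <= dl -> m * k ^+ 2 <= 4 * (1 - e) ^+ 2 * L ->
  8 * dl <= e -> 16 * t ^+ 2 <= e ->
  m * ((k - ln (1 + k)) / 2 + dl * k ^+ 2 + 2 * (k * t) ^+ 2) <= (1 - e) * L.
Proof.
move=> m0 k0 L0 /andP[e0 e1] dl0 mk dle te.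
have k2 : 0 <= k ^+ 2 by exact: sqr_ge0.
apply: (@le_trans _ _ (m * (k ^+ 2 / 4 * (1 + e)))).
  apply: ler_wpM2l => //; have := subr_ln1D_le k0.
  rewrite exprMn; nra.
have : m * k ^+ 2 * (1 + e) <= 4 * (1 - e) ^+ 2 * L * (1 + e).
  by apply: ler_wpM2r => //; lra.
have : 0 <= (1 - e) * L * e ^+ 2 by rewrite !mulr_ge0 ?sqr_ge0// subr_ge0.
nra.
Qed.

(** The three errors, from the variance, the tilt and the mean, share a budget
    [F * x], and [(1 - x) ^ 2 (1 + x) <= 1 - x]. *)
Lemma constant_rate m k L K F x dl A : 0 <= k -> 0 <= L -> 0 <= K ->
  0 < F -> F = (K - ln (1 + K)) / 2 -> 0 <= x <= 1 ->
  F * m <= (1 - x) ^+ 2 * L -> 3 * `|k - K| <= 2 * (F * x) ->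
  3 * (dl * k ^+ 2) <= F * x -> 6 * A <= F * x -> 0 <= m ->
  m * ((k - ln (1 + k)) / 2 + dl * k ^+ 2 + 2 * A) <= (1 - x) * L.
Proof.
move=> k0 L0 K0 F0 FE /andP[x0 x1] mF kK dlk AF m0.
apply: (@le_trans _ _ (m * (F * (1 + x)))).
  apply: ler_wpM2l => //; have := subr_ln1D_lip K0 k0.
  rewrite -FE; lra.
have : F * m * (1 + x) <= (1 - x) ^+ 2 * L * (1 + x).
  by apply: ler_wpM2r => //; lra.
have : 0 <= (1 - x) * L * x ^+ 2 by rewrite !mulr_ge0 ?sqr_ge0// subr_ge0.
nra.
Qed.

Lemma ler_sqr_of_le_sqrt x y L : 0 <= x -> 0 <= L ->
  Num.sqrt x <= y * Num.sqrt L -> x <= y ^+ 2 * L.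
Proof.
move=> x0 L0 xy; rewrite -[x]sqr_sqrtr// -[L]sqr_sqrtr// -exprMn.
by rewrite lerXn2r ?nnegrE ?sqrtr_ge0// (le_trans _ xy) ?sqrtr_ge0.
Qed.

Lemma near_littleo (f eps : R^nat) c : 0 < c -> f =o_\oo eps ->
  (\forall n \near \oo, 0 < eps n) -> \forall n \near \oo, `|f n| <= c * eps n.
Proof.
move=> c0 /eqoP fo e0; near=> n.
have ne0 : 0 < eps n by near: n.
by rewrite -[X in _ * X]gtr0_norm//; near: n; exact: fo.
Unshelve. all: end_near. Qed.

End two_regimes.

Unset Implicit Arguments.

Theorem theorem4p3 (R : realType)
  (d : nat -> measure_display) (T : forall n : nat, measurableType (d n))
  (P : forall n : nat, probability (T n) R)
  (Z : forall n : nat, 'I_n -> {RV (P n) >-> R})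
  (Z_iid : forall n : nat, iid_std_normal (Z n))
  (sigma0 : R) (sigma0_gt0 : 0 < sigma0)
  (len : R^nat)
  (len_bounds : forall n : nat, (0 < n)%N -> 0 < len n <= 1)
  (len_inv_nat : forall n : nat, (0 < n)%N -> (len n)^-1 \is a Num.nat)
  (len_mul_nat : forall n : nat, (0 < n)%N -> n%:R * len n \is a Num.nat)
  (len_cvg0 : len @ \oo --> (0 : R))
  (eps : R^nat)
  (eps_cvg0 : eps @ \oo --> (0 : R))
  (eps_sqrt_log : (fun n => eps n * Num.sqrt (- ln (len n))) @ \oo --> +oo) :
  (forall Delta sigma theta : R^nat,
     (forall n : nat, (0 < n)%N -> 0 < Delta n) ->
     (forall n : nat, (0 < n)%N -> 0 < sigma n) ->
     (forall n : nat, (0 < n)%N -> sigma0 * Delta n = sigma n ^+ 2 * theta n) ->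
     Delta @ \oo --> (0 : R) ->
     sigma @ \oo --> (0 : R) ->
     theta @ \oo --> (0 : R) ->
     (fun n => sigma n ^+ 2) =o_\oo eps ->
     (fun n => theta n ^+ 2) =o_\oo eps ->
     (\forall n \near \oo,
        Num.sqrt (n%:R * len n) * Delta n <=
          (2 * sigma0 - eps n) * Num.sqrt (- ln (len n)) * theta n) ->
     undetectable Z sigma0 Delta sigma len)
  /\
  (forall (Delta sigma : R^nat) (s : R) (r : R^nat),
     (forall n : nat, (0 < n)%N -> 0 < Delta n) ->
     (forall n : nat, (0 < n)%N -> 0 < sigma n) ->
     0 < s ->
     (forall n : nat, (0 < n)%N -> sigma n = s * (1 + r n)) ->
     r =o_\oo eps ->
     (fun n => Delta n ^+ 2) =o_\oo eps ->
     let kappa := s / sigma0 in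
     let C := (Num.sqrt (kappa ^+ 2 / 2 - 2^-1 * ln (1 + kappa ^+ 2)))^-1 in
     (\forall n \near \oo,
        Num.sqrt (n%:R * len n) <= (C - eps n) * Num.sqrt (- ln (len n))) ->
     undetectable Z sigma0 Delta sigma len).
Proof.
have e_gt0 := near_eps_gt0 eps_sqrt_log.
have e_le c : 0 < c -> \forall n \near \oo, eps n <= c.
  exact: near_eps_le.
have Lg0 n : (0 < n)%N -> 0 <= - ln (len n).
  by move=> n0; have /andP[_ l1] := len_bounds n n0; rewrite oppr_ge0 ln_le0.
have m0 n : (0 < n)%N -> 0 <= n%:R * len n.
  by move=> n0; have /andP[l0 _] := len_bounds n n0; rewrite mulr_ge0// ltW.
have ne0 : sigma0 != 0 by rewrite gt_eqF.
split.
(* The relative gap is [e = eps / (2 sigma0)], whence the value of [b]; the value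
   of [c] makes the tilt [8 * (c * eps)] equal to [e]. *)
- move=> Delta sigma theta D0 s0 Ds _ _ _ so to rate.
  have b0 : 0 < (2 * sigma0)^-1 by rewrite invr_gt0 mulr_gt0.
  have c0 : 0 < (16 * sigma0)^-1 by rewrite invr_gt0 mulr_gt0.
  apply: (undetectable_of_rate Z_iid sigma0_gt0 len_bounds len_inv_nat
    len_mul_nat eps_cvg0 eps_sqrt_log b0 c0).
  + near=> n.
    have e0 : 0 < eps n by near: n.
    have k1 : (sigma n / sigma0) ^+ 2 <= 1.
      rewrite expr_div_n ler_pdivrMr ?exprn_gt0// mul1r.
      apply: (@le_trans _ _ (1 * eps n)).
        rewrite -[leLHS]ger0_norm ?sqr_ge0//.
        by near: n; exact: near_littleo.
      by rewrite mul1r; near: n; apply: e_le; exact: exprn_gt0.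
    have e8 : eps n <= 8 * sigma0 by near: n; apply: e_le; exact: mulr_gt0.
    apply: (@le_trans _ _ ((16 * sigma0)^-1 * eps n * 1)).
      by apply: ler_wpM2l => //; rewrite mulr_ge0 ?ltW.
    by rewrite mulr1 mulrC ler_pdivrMr ?mulr_gt0//; lra.
  near=> n.
  have n0 : (0 < n)%N by near: n; exists 1%N.
  have e0 : 0 < eps n by near: n.
  have e2 : eps n <= 2 * sigma0 by near: n; apply: e_le; exact: mulr_gt0.
  have th : theta n ^+ 2 <= (32 * sigma0)^-1 * eps n.
    rewrite -[leLHS]ger0_norm ?sqr_ge0//; near: n; apply: near_littleo => //.
    by rewrite invr_gt0 mulr_gt0.
  have rt : Num.sqrt (n%:R * len n) * Delta n <=
      (2 * sigma0 - eps n) * Num.sqrt (- ln (len n)) * theta n by near: n.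
  set k := (sigma n / sigma0) ^+ 2.
  have sE : sigma n ^+ 2 = sigma0 ^+ 2 * k by rewrite /k; field.
  have DE : Delta n / sigma0 = k * theta n.
    apply: (mulfI ne0); rewrite mulrCA divff// mulr1.
    apply: (mulfI ne0); rewrite Ds// sE; ring.
  have th0 : 0 < theta n.
    have := mulr_gt0 sigma0_gt0 (D0 n n0); rewrite Ds// pmulr_rgt0//.
    by rewrite exprn_gt0// s0.
  rewrite DE.
  have -> : (2 * sigma0)^-1 * eps n = eps n / (2 * sigma0) by rewrite mulrC.
  apply: vanishing_rate.
  + exact: m0.
  + exact: sqr_ge0.
  + exact: Lg0.
  + have s2 : 0 < 2 * sigma0 by exact: mulr_gt0.
    apply/andP; split; first by rewrite divr_ge0 ?ltW.
    by rewrite ler_pdivrMr// mul1r.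
  + by rewrite mulr_ge0 ?ltW.
  + have k0 : 0 < k by rewrite exprn_gt0// divr_gt0// s0.
    have : Num.sqrt (n%:R * len n) <=
        ((2 * sigma0 - eps n) / (sigma0 * k)) * Num.sqrt (- ln (len n)).
      rewrite -(ler_pM2r (mulr_gt0 (mulr_gt0 sigma0_gt0 k0) th0)).
      have -> : sigma0 * k * theta n = Delta n by rewrite -mulrA -DE; field.
      apply: (le_trans rt); rewrite le_eqVlt; apply/orP; left; apply/eqP.
      have -> : Delta n = sigma0 * k * theta n by rewrite -mulrA -DE; field.
      by field; rewrite ne0 gt_eqF.
    move/(ler_sqr_of_le_sqrt (m0 n n0) (Lg0 n n0)) => h.
    have := ler_wpM2r (sqr_ge0 k) h; move/le_trans; apply.
    rewrite le_eqVlt; apply/orP; left; apply/eqP.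
    by field; rewrite ne0 gt_eqF.
  + rewrite le_eqVlt; apply/orP; left; apply/eqP; field => //.
  + have := ler_wpM2l (ler0n R 16) th; move/le_trans; apply.
    rewrite le_eqVlt; apply/orP; left; apply/eqP; field => //.
move=> Delta sigma s r _ _ s0 sigE ro Do kappa C rate.
pose K := kappa ^+ 2; pose F := (K - ln (1 + K)) / 2.
have kap0 : 0 < kappa by rewrite divr_gt0.
have K0 : 0 < K by rewrite exprn_gt0.
have CE : C = (Num.sqrt F)^-1.
  by rewrite /C /F -/K; congr (Num.sqrt _)^-1; field.
clearbody C.
have F0 : 0 < F.
  rewrite divr_gt0// subr_gt0 -ltr_expR lnK ?posrE ?expR_gt1Dx ?gt_eqF//.
  by rewrite addr_gt0.
have b0 : 0 < Num.sqrt F by rewrite sqrtr_gt0.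
have FF : F = Num.sqrt F ^+ 2 by rewrite sqr_sqrtr// ltW.
have FE : F = (K - ln (1 + K)) / 2 by [].
have KE : K = (s / sigma0) ^+ 2 by [].
clearbody F K; clear kappa kap0.
(* The relative gap is [x = eps / C = sqrt F * eps]; as [k] is eventually at most
   [4 K], this [c] keeps the tilt [c * eps * k ^+ 2] within [F * x / 3]. *)
pose c := F * Num.sqrt F / (48 * K ^+ 2).
have c0 : 0 < c by rewrite divr_gt0// mulr_gt0// exprn_gt0.
have cE : c = F * Num.sqrt F / (48 * K ^+ 2) by [].
clearbody c.
have r1 : \forall n \near \oo, `|r n| <= 1.
  near=> n; apply: (@le_trans _ _ (1 * eps n)).
    by near: n; exact: near_littleo.
  by rewrite mul1r; near: n; exact: e_le.
have kE n : (0 < n)%N -> (sigma n / sigma0) ^+ 2 = K * (1 + r n) ^+ 2.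
  by move=> n0; rewrite sigE// KE; field.
have k4 : \forall n \near \oo, (sigma n / sigma0) ^+ 2 <= 4 * K.
  near=> n; have n0 : (0 < n)%N by near: n; exists 1%N.
  rewrite kE// mulrC ler_pM2r//.
  have : `|r n| <= 1 by near: n.
  by rewrite ler_norml; nra.
apply: (undetectable_of_rate Z_iid sigma0_gt0 len_bounds len_inv_nat
  len_mul_nat eps_cvg0 eps_sqrt_log b0 c0).
- near=> n.
  have e0 : 0 < eps n by near: n.
  have k4n : (sigma n / sigma0) ^+ 2 <= 4 * K by near: n.
  apply: (@le_trans _ _ (c * eps n * (4 * K))).
    by apply: ler_wpM2l => //; rewrite mulr_ge0 ?ltW.
  have : eps n <= (8 * K * c)^-1.
    by near: n; apply: e_le; rewrite invr_gt0 mulr_gt0// mulr_gt0.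
  rewrite -[leRHS]mul1r ler_pdivlMr; last by rewrite mulr_gt0// mulr_gt0.
  have -> : c * eps n * (4 * K) = eps n * (8 * K * c) / 2 by field.
  lra.
near=> n.
have n0 : (0 < n)%N by near: n; exists 1%N.
have e0 : 0 < eps n by near: n.
have k4n : (sigma n / sigma0) ^+ 2 <= 4 * K by near: n.
have r1n : `|r n| <= 1 by near: n.
have rt : Num.sqrt (n%:R * len n) <= (C - eps n) * Num.sqrt (- ln (len n)).
  by near: n.
have rn : `|r n| <= 2 * (F * Num.sqrt F) / (9 * K) * eps n.
  by near: n; apply: near_littleo => //; rewrite divr_gt0// !mulr_gt0.
have Dn : Delta n ^+ 2 <= F * Num.sqrt F * sigma0 ^+ 2 / 6 * eps n.
  rewrite -[leLHS]ger0_norm ?sqr_ge0//; near: n; apply: near_littleo => //.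
  by rewrite divr_gt0 ?mulr_gt0 ?exprn_gt0.
apply: (@constant_rate _ _ _ _ K F) => //.
- exact: sqr_ge0.
- exact: Lg0.
- exact: ltW.
- apply/andP; split; first by rewrite mulr_ge0 ?ltW.
  rewrite mulrC -ler_pdivlMr// mul1r.
  by near: n; apply: e_le; rewrite invr_gt0.
- have := ler_wpM2l (ltW F0) (ler_sqr_of_le_sqrt (m0 n n0) (Lg0 n n0) rt).
  move/le_trans; apply; rewrite CE le_eqVlt; apply/orP; left; apply/eqP.
  by rewrite {1}FF; field; rewrite gt_eqF.
- rewrite kE//.
  have -> : K * (1 + r n) ^+ 2 - K = K * (r n * (2 + r n)) by ring.
  rewrite normrM (gtr0_norm K0) normrM.
  have r3 : `|2 + r n| <= 3.
    by apply: (le_trans (ler_normD _ _)); rewrite ger0_norm//; lra.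
  have : K * (`|r n| * `|2 + r n|) <= K * (`|r n| * 3).
    by rewrite ler_pM2l// ler_wpM2l.
  have : 9 * K * `|r n| <= 9 * K * (2 * (F * Num.sqrt F) / (9 * K) * eps n).
    by rewrite ler_pM2l// mulr_gt0.
  have -> : 9 * K * (2 * (F * Num.sqrt F) / (9 * K) * eps n) =
      2 * (F * (Num.sqrt F * eps n)) by field; rewrite gt_eqF.
  lra.
- have : (sigma n / sigma0) ^+ 2 ^+ 2 <= (4 * K) ^+ 2.
    by rewrite lerXn2r// nnegrE ?sqr_ge0// mulr_ge0// ltW.
  move=> h; have := ler_wpM2l (mulr_ge0 (ltW c0) (ltW e0)) h.
  have -> : c * eps n * (4 * K) ^+ 2 = F * (Num.sqrt F * eps n) / 3.
    by rewrite cE; field; rewrite gt_eqF.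
  lra.
- rewrite expr_div_n mulrA ler_pdivrMr ?exprn_gt0//; lra.
- exact: m0.
Unshelve. all: end_near.
Qed.
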